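(* Let $X$ be a homogeneous topological space with a regular $G_\delta$-diagonal. Then $$|X|\le wL(X)^{\pi\chi(X)}.$$
   Context: $X$ is homogeneous if for all $x,y\in X$ there is a homeomorphism of $X$ onto itself mapping $x$ to $y$. The diagonal of $X^2$ is $\Delta_X=\{(x,x):x\in X\}$. A space $X$ has a regular $G_\delta$-diagonal if $\Delta_X$ is the intersection of countably many closed neighbourhoods of $\Delta_X$ in $X^2$, i.e. there are open sets $U_n\subseteq X^2$ ($n<\omega$) with $\Delta_X=\bigcap_{n<\omega}U_n=\bigcap_{n<\omega}\overline{U_n}$. The weak Lindelöf number $wL(X)$ is the least cardinal $\kappa$ such that every open cover of $X$ has a subfamily of cardinality at most $\kappa$ whose union is dense in $X$. A local $\pi$-base at $x\in X$ is a family $\mathcal{V}$ of non-empty open subsets of $X$ such that every open neighbourhood of $x$ contains a member of $\mathcal{V}$; the $\pi$-character $\pi\chi(X)$ is the supremum over $x\in X$ of the least cardinality of a local $\pi$-base at $x$. *)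

(* Defs.v *)
From HB Require Import structures.
From mathcomp Require Import all_boot.
From mathcomp Require Import all_classical topology.

Set Implicit Arguments.
Unset Strict Implicit.
Unset Printing Implicit Defensive.

Local Open Scope classical_set_scope.
Local Open Scope card_scope.

(* A cardinal is represented by any type K of that cardinality; types are
   compared by [set: K] #<= [set: K'], and the function type L -> K represents
   the power K ^ L. *)

(* Take, by Zorn's lemma, a maximal set S of choice functions on which each
   projection is injective; some projection maps S onto its codomain. *)
Lemma least_card_family (I : Type) (i0 : I) (T : I -> Type) :
  exists i, forall j, exists f : T i -> T j, injective f.
Proof.
pose prd := forall i : I, T i.
pose inj (S : set prd) :=
  forall (i : I) (s t : prd), S s -> S t -> s i = t i -> s = t.
have [F Finj Ftot|S [Sinj Smax]] := @Zorn_bigcup prd inj.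
  move=> i s t [A FA As] [B FB Bt].
  by have [AB|BA] := Ftot A B FA FB;
    [apply: Finj FB i s t (AB _ As) Bt|apply: Finj FA i s t As (BA _ Bt)].
have [i isurj] : exists i : I, forall k : T i, exists2 s, S s & s i = k.
  apply: contrapT => /forallNP nsurj.
  have miss (i : I) : exists k : T i, forall s, S s -> s i <> k.
    have /existsNP[k nk] := nsurj i.
    by exists k => s Ss sik; apply: nk; exists s.
  pose t : prd := fun i => sval (cid (miss i)).
  have tS s i : S s -> s i <> t i by exact: (svalP (cid (miss i))).
  apply: (Smax (S `|` [set t])).
    split; first by move=> s Ss; left.
    by move=> /(_ t (or_intror erefl)) St; exact: (tS t i0 St).
  move=> i s s' [Ss|->] [Ss'|->] // e; first exact: Sinj e.
    by have := tS s i Ss.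
  by have := tS s' i Ss'; rewrite e.
exists i => j; pose h (k : T i) : T j := (sval (cid2 (isurj k))) j.
exists h => k k'; rewrite /h.
case: (cid2 _) => s Ss sk; case: (cid2 _) => s' Ss' s'k'.
by move=> /= /(Sinj j s s' Ss Ss') e; rewrite -sk -s'k' e.
Qed.

Lemma injective_card_le (A B : Type) (f : A -> B) :
  injective f -> [set: A] #<= [set: B].
Proof.
move=> finj; have [g] : $|{injfun [set: A] >-> [set: B]}|.
  by apply/injfunPex; exists f => // x y _ _; exact: finj.
exact: inj_card_le g.
Qed.

Lemma least_cardinal_exists (P : Type -> Prop) : (exists K, P K) ->
  exists K, P K /\ forall K', P K' -> [set: K] #<= [set: K'].
Proof.
move=> [K0 PK0].
pose I := {A : set K0 | exists K, P K /\ A #= [set: K]}.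
have i0 : I by exists setT, K0.
have [[A [K [PK AK]]] Amin] := least_card_family i0 (fun i : I => sval i).
exists K; split=> // K' PK'; rewrite -(card_le_eql AK).
have [[] ltot] := least_card_family true (fun b : bool => if b then K' else K0).
  have [g /= ginj] := ltot false.
  have gK' : range g #= [set: K'] by apply: inj_card_eq => x y _ _; exact: ginj.
  have [f /= finj] := Amin (exist _ (range g) (ex_intro _ K' (conj PK' gK'))).
  rewrite -(card_le_eqr gK') -(card_le_eql (card_setT A)).
  by rewrite -(card_le_eqr (card_setT (range g))); exact: injective_card_le finj.
have [g /= ginj] := ltot true.
exact: card_le_trans (card_leT A) (injective_card_le ginj).
Qed.

(* The least cardinal satisfying P (with junk value void if there is none). *)
Definition least_cardinal (P : Type -> Prop) : Type :=
  if pselect (exists K, P K) is left PK then sval (cid (least_cardinal_exists PK))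
  else void.

Lemma least_cardinalP (P : Type -> Prop) : (exists K, P K) ->
  P (least_cardinal P) /\
  forall K, P K -> [set: least_cardinal P] #<= [set: K].
Proof.
rewrite /least_cardinal; case: pselect => // PK _.
exact: (svalP (cid (least_cardinal_exists PK))).
Qed.

Section CardinalFunctions.
Variable X : topologicalType.

Definition homogeneous :=
  forall x y : X, exists f g : X -> X,
    [/\ continuous f, continuous g, cancel f g, cancel g f & f x = y].

Definition regular_Gdelta_diagonal :=
  exists U : nat -> set (X * X),
    [/\ forall n, open (U n),
        diagonal = \bigcap_n U n &
        diagonal = \bigcap_n closure (U n)].

Definition weakly_Lindelof_at (K : Type) :=
  forall C : set (set X), C `<=` open -> \bigcup_(O in C) O = setT ->
    exists D : set (set X),
      [/\ D `<=` C, D #<= [set: K] & dense (\bigcup_(O in D) O)].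

Definition weak_Lindelof_number : Type := least_cardinal weakly_Lindelof_at.

Definition local_pi_base (x : X) (V : set (set X)) :=
  (forall A, V A -> open A /\ A !=set0) /\
  (forall O, open_nbhs x O -> exists2 A, V A & A `<=` O).

Definition point_pi_character (x : X) : Type :=
  least_cardinal (fun K =>
    exists2 V : set (set X), local_pi_base x V & V #= [set: K]).

(* The supremum of a family of cardinals is its least upper bound. *)
Definition pi_character : Type :=
  least_cardinal (fun K =>
    forall x : X, [set: point_pi_character x] #<= [set: K]).

(* The junk value of least_cardinal is not used in the definitions above. *)

Lemma weak_Lindelof_numberP :
  weakly_Lindelof_at weak_Lindelof_number /\
  forall K, weakly_Lindelof_at K -> [set: weak_Lindelof_number] #<= [set: K].
Proof.
apply: least_cardinalP; exists (set X) => C _ CT; exists C; split => //.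
  exact: card_leT.
by rewrite CT => O O0 _; rewrite setIT.
Qed.

Lemma point_pi_characterP (x : X) :
  (exists2 V : set (set X),
     local_pi_base x V & V #= [set: point_pi_character x]) /\
  forall K (V : set (set X)), local_pi_base x V -> V #= [set: K] ->
    [set: point_pi_character x] #<= [set: K].
Proof.
have [|] := @least_cardinalP (fun K =>
    exists2 V : set (set X), local_pi_base x V & V #= [set: K]).
  pose V := [set A : set X | open A /\ A !=set0].
  exists V; exists V; last by rewrite card_eq_sym; exact: card_setT.
  by split=> // O [oO Ox]; exists O => //; split => //; exists x.
by move=> ? m; split=> // K V xV VK; apply: m; exists V.
Qed.

Lemma pi_characterP :
  (forall x : X, [set: point_pi_character x] #<= [set: pi_character]) /\
  forall K, (forall x : X, [set: point_pi_character x] #<= [set: K]) ->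
    [set: pi_character] #<= [set: K].
Proof.
apply: least_cardinalP; exists (set X) => x.
have [[V _ Vx] _] := point_pi_characterP x.
by rewrite -(card_le_eql Vx); exact: card_leT.
Qed.

End CardinalFunctions.

(* Main.v *)
Require Import Defs.
From mathcomp Require Import all_boot.
From mathcomp Require Import all_classical topology.

(** A regular G_delta-diagonal yields open covers [C n], each refining the
    previous ones, such that distinct points have neighbourhoods that no single
    member of some [C n] can both meet.  Fix a point p, a local pi-base [v] at p
    and homeomorphisms h_x taking p to x.  If no point is isolated, no [v k]
    lies in a member of [C n] for every n, so a level [N k] at which it fails
    can be attached to [v k].  Map x to the function sending k to (an index of)
    a member of the dense subfamily of [C (N k)] that meets h_x(v k).  Given
    x <> y separated at level n, some [v k] is small enough to be sent by h_x
    and h_y into the separating neighbourhoods and to lie in a member of [C n];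
    then [N k > n] and the functions of x and y differ at k.  Attaching the
    level to k avoids the cardinal arithmetic k * omega = k.  If a point is
    isolated, then X is discrete and has wL(X) points. *)

Local Open Scope classical_set_scope.
Local Open Scope card_scope.

Lemma card_le_setT_range (T K : Type) (A : set T) :
  A !=set0 -> A #<= [set: K] -> exists s : K -> T, range s = A.
Proof.
move=> /set0P A0 /pfcard_geP[A0'|]; first by rewrite A0' eqxx in A0.
by move=> /surjfunPex[s ->]; exists s.
Qed.

Lemma open_diagonal_square (X : topologicalType) (G : set (X * X)) (x : X) :
  open G -> G (x, x) -> exists2 W, open_nbhs x W & W `*` W `<=` G.
Proof.
move=> oG Gx; have /= : nbhs (x, x) G by exact: open_nbhs_nbhs.
case=> -[A B] /= [Ax Bx] ABG.
have : nbhs x (A `&` B) by exact: filterI.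
rewrite nbhsE => -[W Wx WAB]; exists W => // -[a b] [/= Wa Wb].
by apply: ABG; split=> /=; [case: (WAB a Wa)|case: (WAB b Wb)].
Qed.

(** Zenor's characterization of a regular G_delta-diagonal by open covers, with the covers also
    taken to be nested. *)
Definition separating_covers (X : topologicalType) (C : nat -> set (set X)) :=
  [/\ forall n, C n `<=` open,
      forall n x, exists2 W, C n W & W x,
      forall m n, (m <= n)%N -> C n `<=` C m &
      forall x y, x <> y -> exists n A B, [/\ open_nbhs x A, open_nbhs y B &
        forall W, C n W -> W `&` A !=set0 -> W `&` B !=set0 -> False]].

Lemma regular_Gdelta_separating_covers (X : topologicalType) :
  regular_Gdelta_diagonal X -> exists C, @separating_covers X C.
Proof.
move=> [U [oU dU dcU]]; pose G n := \bigcap_(k < n) U k.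
have oG n : open (G n).
  by rewrite /G bigcap_mkord; elim/big_ind: _; [exact: openT|exact: openI|].
have Gxx n x : G n (x, x).
  move=> k _; have : diagonal (x, x) by [].
  by rewrite dU; exact.
exists (fun n => [set W | open W /\ W `*` W `<=` G n]); split.
- by move=> n W [].
- move=> n x; have [W [oW Wx] WG] := open_diagonal_square X _ x (oG n) (Gxx n x).
  by exists W.
- move=> m n mn W [oW WG]; split => // z Wz k km.
  by apply: (WG z Wz); exact: leq_trans km mn.
move=> x y xy.
have /existsNP[n] : ~ forall n, closure (U n) (x, y).
  move=> xyU; have : diagonal (x, y) by rewrite dcU => n _; exact: xyU.
  by move/diagonalP.
move=> /existsNP[Q] /not_implyP[[[A B] /= [Ax By] ABQ]] UQ.
move: Ax By; rewrite !nbhsE => -[A' A'x A'A] [B' B'y B'B].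
(* [G n] intersects only the [U k] with k < n, so [G n.+1] is the first one inside [U n]. A member
   [W] meeting both sets would give a point of [U n] in the box [A] x [B], which misses [U n]. *)
exists n.+1, A', B'; split=> // W [oW WG] [a [Wa Aa]] [b [Wb Bb]].
apply: UQ; exists (a, b); split; first by apply: (WG (a, b)) => //=.
by apply: ABQ; split=> /=; [exact: A'A|exact: B'B].
Qed.

Lemma homogeneous_isolated_discrete (X : topologicalType) (a : X) :
  homogeneous X -> open [set a] -> forall x : X, open [set x].
Proof.
move=> hX oa x; have [f [g [cf cg fg gf fx]]] := hX x a.
have -> : [set x] = f @^-1` [set a].
  apply/seteqP; split=> [z ->//|z fz].
  by rewrite /= -(fg z) fz -fx fg.
by move/continuousP : cf; exact.
Qed.

(** In the cover by singletons, a subfamily with dense union must contain every singleton. *)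
Lemma discrete_card_le_weak_Lindelof_number (X : topologicalType) :
  (forall x : X, open [set x]) -> [set: X] #<= [set: weak_Lindelof_number X].
Proof.
move=> o1; have [/(_ (range set1)) wL _] := weak_Lindelof_numberP X.
have [||D [DC DwL dD]] := wL.
- by move=> _ [x _ <-].
- by apply/seteqP; split=> // x _; exists [set x] => //; exists x.
have D1 x : D [set x].
  have [_ [-> [O DO Ox]]] := dD [set x] (ex_intro _ x erefl) (o1 x).
  by have [y _ yO] := DC _ DO; move: Ox DO; rewrite -yO => ->.
apply: card_le_trans DwL.
have eqX : range (@set1 X) #= [set: X].
  by apply: inj_card_eq => x y _ _ /seteqP[/(_ x erefl)].
by rewrite -(card_le_eql eqX); apply: subset_card_le => _ [x _ <-].
Qed.

(** A least local pi-base at [p] may have fewer members than [pi_character X]; being nonempty, it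
    can be listed with repetitions along the whole type. *)
Lemma pi_character_local_pi_base (X : topologicalType) (p : X) :
  exists v : pi_character X -> set X, local_pi_base p (range v).
Proof.
have [[V pV Vp] _] := point_pi_characterP p.
have [/(_ p) ple _] := pi_characterP X.
have V0 : V !=set0.
  have [A VA _] := pV.2 setT (conj openT I).
  by exists A.
have [|v vV] := card_le_setT_range _ (pi_character X) _ V0.
  by rewrite (card_le_eql Vp).
by exists v; rewrite vV.
Qed.

Lemma weak_Lindelof_number_cover (X : topologicalType) (p : X)
    (C : set (set X)) :
  C `<=` open -> (forall x, exists2 W, C W & W x) ->
  exists s : weak_Lindelof_number X -> set X,
    range s `<=` C /\ dense (\bigcup_(W in range s) W).
Proof.
move=> oC cC; have [/(_ C oC) wL _] := weak_Lindelof_numberP X.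
have [|D [DC DwL dD]] := wL.
  by apply/seteqP; split=> // x _; have [W CW Wx] := cC x; exists W.
have [|s sD] := card_le_setT_range _ (weak_Lindelof_number X) D _ DwL.
  have [_ [_ [W DW _]]] := dD setT (ex_intro _ p I) openT.
  by exists W.
by exists s; rewrite sD.
Qed.

Lemma no_isolated_card_le (X : topologicalType) :
  homogeneous X -> regular_Gdelta_diagonal X ->
  (forall x : X, ~ open [set x]) ->
  [set: X] #<= [set: pi_character X -> weak_Lindelof_number X].
Proof.
move=> hX /regular_Gdelta_separating_covers[C [oC cC decC sepC]] niso.
have [[p _]|X0] := pselect ([set: X] !=set0); last first.
  suff -> : [set: X] = set0 by exact: card_ge0.
  by apply/seteqP; split=> // x _; apply: X0; exists x.
have [v [vo vp]] := pi_character_local_pi_base X p.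
have [s sP] := choice (fun n => weak_Lindelof_number_cover X p _ (oC n) (cC n)).
have [h hP] := choice (fun x => hX p x).
have {hP}[g hP] := choice hP.
(* Otherwise no two points of [v k] could be separated, and [v k] would be an open singleton. *)
have /choice[N NP] k : exists n, ~ exists2 W, C n W & v k `<=` W.
  apply: contrapT => /forallNP vC.
  have [ov [a va]] := vo _ (imageT v k).
  apply: (niso a); suff <- : v k = [set a] by [].
  apply/seteqP; split=> [b vb|_ -> //]; apply: contrapT => /= /sepC.
  move=> [n [A [B [[_ Ab] [_ Ba] sep]]]].
  have [W CW vW] := contrapT (vC n).
  by apply: sep CW _ _; [exists b|exists a]; split=> //; exact: vW.
(* The image of [v k] under [h x] is written as a preimage under the inverse [g x], so that
   continuity makes it open. *)
have FP x k : exists c, s (N k) c `&` g x @^-1` v k !=set0.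
  have [ov [a va]] := vo _ (imageT v k).
  have [_ cg fg gf _] := hP x.
  have og : open (g x @^-1` v k) by move/continuousP : cg; exact.
  have gv0 : g x @^-1` v k !=set0 by exists (h x a); rewrite /= fg.
  have [b [gb [_ [c _ <-] sb]]] := (sP (N k)).2 _ gv0 og.
  by exists c, b.
pose F x k := sval (cid (FP x k)).
have FxP x k : s (N k) (F x k) `&` g x @^-1` v k !=set0 := svalP (cid (FP x k)).
apply: (@injective_card_le _ _ F) => x y Fxy; apply: contrapT => /sepC.
move=> [n [A [B [[oA Ax] [oB By] sep]]]].
have [W CW Wp] := cC n p.
have [cx _ _ gfx hx] := hP x; have [cy _ _ gfy hy] := hP y.
have [|_ [k _ <-] vO] := vp (h x @^-1` A `&` h y @^-1` B `&` W).
- split; last by split=> //; rewrite /= hx hy.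
  apply: openI; last exact: (oC n).
  by apply: openI; [move/continuousP : cx|move/continuousP : cy]; exact.
(* This is why [W] was intersected in: by nesting, a smaller [N k] would put [W], which contains
   [v k], in [C (N k)]. *)
have nN : (n <= N k)%N.
  rewrite leqNgt; apply/negP => /ltnW Nn; apply: (NP k).
  by exists W; [exact: (decC _ n Nn)|move=> z /vO[]].
(* Nesting now brings the common value of [F x] and [F y] at [k] into [C n], where it meets both [A]
   and [B]. *)
have CF : C n (s (N k) (F x k)) by apply: decC nN _ _; apply: (sP _).1; exact: imageT.
apply: sep CF _ _.
  have [b [sb gb]] := FxP x k; exists b; split=> //.
  by have [[]] := vO _ gb; rewrite /= gfx.
have [b [sb gb]] := FxP y k; exists b; split; first by rewrite Fxy.
by have [[]] := vO _ gb; rewrite /= gfy.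
Qed.

Theorem proposition4p10 (X : topologicalType)
  (hX : homogeneous X) (dX : regular_Gdelta_diagonal X) :
  [set: X] #<= [set: pi_character X -> weak_Lindelof_number X].
Proof.
have [[a oa]|/forallNP niso] := pselect (exists a : X, open [set a]); last first.
  exact: no_isolated_card_le.
have XwL := discrete_card_le_weak_Lindelof_number X
  (homogeneous_isolated_discrete X a hX oa).
apply: card_le_trans XwL _.
(* Constant functions embed the base into the power only if the exponent is inhabited; an index of a
   pi-base member provides [k]. *)
have [v [_ /(_ setT (conj openT I))[_ [k _ _] _]]] := pi_character_local_pi_base X a.
by apply: (@injective_card_le _ _ (fun c _ => c)) => c d /(congr1 (@^~ k)).
Qed.
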